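(* Let $\psi\in\Sigma$. Then for all $z\in\mathbb{D}_e$, $$\mathrm{S}_4(\psi)(z)=\frac15\big(\mathrm{S}_2(\psi)\big)''(z)-\frac65\big(\mathrm{S}_2(\psi)(z)\big)^2=\frac1{30}\Big(\big(\mathrm{S}(\psi)\big)''(z)-\big(\mathrm{S}(\psi)(z)\big)^2\Big).$$
   Context: $\mathbb{D}_e=\{z\in\mathbb{C}:|z|>1\}$. $\Sigma$ is the class of univalent (injective holomorphic) functions $\psi:\mathbb{D}_e\to\mathbb{C}$ with Laurent expansion $\psi(z)=z+b_0+b_1z^{-1}+\cdots$. For $\psi\in\Sigma$, $Q_e(z,w)=\log\frac{\psi(z)-\psi(w)}{z-w}$ is the holomorphic function on $\mathbb{D}_e^2$ (quotient read as $\psi'(z)$ on $z=w$) given by the branch of the logarithm vanishing when $z=\infty$ or $w=\infty$. The diagonal series Schwarzian derivatives are $\mathrm{S}_{2n}(\psi)(z)=(\partial_z^n\partial_w^nQ_e)(z,z)$, $n=0,1,2,\dots$. $\mathrm{S}(\psi)=\big(\frac{\psi''}{\psi'}\big)'-\frac12\big(\frac{\psi''}{\psi'}\big)^2$ is the usual Schwarzian derivative, and $\mathrm{S}_2(\psi)=\frac16\mathrm{S}(\psi)$. *)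

(* Defs.v *)
From Stdlib Require Import Reals.
From Coquelicot Require Import Coquelicot.
Open Scope C_scope.

Definition De (z : C) : Prop := (1 < Cmod z)%R.

Definition C_holomorphic_on (U : C -> Prop) (f : C -> C) : Prop :=
  forall z : C, U z -> ex_derive (K := C_AbsRing) (V := C_NormedModule) f z.

(* The class Sigma; functions are total, only their values on [De] matter. *)
Definition Sigma (psi : C -> C) : Prop :=
  C_holomorphic_on De psi /\
  (forall z w : C, De z -> De w -> psi z = psi w -> z = w) /\
  (exists b : nat -> C, forall z : C, De z ->
     is_series (K := C_AbsRing) (V := C_NormedModule)
       (fun n : nat => b n * / (z ^ n)) (psi z - z)).

Definition Cexp (z : C) : C :=
  ((exp (Re z) * cos (Im z))%R, (exp (Re z) * sin (Im z))%R).

Definition C_infinity (P : C -> Prop) : Prop :=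
  exists M : R, forall z : C, (M < Cmod z)%R -> P z.

Definition diff_quot (psi : C -> C) (z w : C) : C :=
  if Ceq_dec z w then C_derive psi z else (psi z - psi w) / (z - w).

(* [Q] is the function Q_e of [psi]: jointly holomorphic on De x De, a
   logarithm of the difference quotient there, and zero at z = oo and w = oo.
   As De x De is connected, these conditions determine [Q] on De x De. *)
Definition is_Qe (psi : C -> C) (Q : C -> C -> C) : Prop :=
  (forall z w : C, De z -> De w ->
     ex_filterdiff (K := C_AbsRing)
       (U := prod_NormedModule C_AbsRing C_NormedModule C_NormedModule)
       (V := C_NormedModule)
       (fun p : C * C => Q (fst p) (snd p)) (locally (z, w))) /\
  (forall z w : C, De z -> De w -> Cexp (Q z w) = diff_quot psi z w) /\
  (forall w : C, De w ->
     filterlim (fun z : C => Q z w) C_infinity (locally (0 : C))) /\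
  (forall z : C, De z ->
     filterlim (fun w : C => Q z w) C_infinity (locally (0 : C))).

Definition C_derive_n (n : nat) (f : C -> C) : C -> C :=
  Nat.iter n C_derive f.

(* For [is_Qe psi Q], [diag_schwarzian n Q] is the diagonal series
   Schwarzian S_{2n}(psi): first d_w^n, then d_z^n, then w = z. *)
Definition diag_schwarzian (n : nat) (Q : C -> C -> C) (z : C) : C :=
  C_derive_n n (fun z' : C => C_derive_n n (fun w' : C => Q z' w') z) z.

Definition pre_schwarzian (psi : C -> C) (z : C) : C :=
  C_derive_n 2 psi z / C_derive psi z.

Definition schwarzian (psi : C -> C) (z : C) : C :=
  C_derive (pre_schwarzian psi) z - 1 / 2 * (pre_schwarzian psi z) ^ 2.

(* Main.v *)
Require Import Defs.
From Stdlib Require Import Reals Lra Lia Psatz Factorial.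
From Coquelicot Require Import Coquelicot.
Open Scope C_scope.

(** Since [exp (Q y w) = (psi y - psi w) / (y - w)], the [w]-derivatives of [Q y] at
    [w = z] are rational in the divided Taylor remainders
    [R_m(y) = (psi y - sum_{j < m} psi^(j)(z) (y - z)^j / j!) / (y - z)^m]: they equal
    [R_2 / R_1] and [2 R_3 / R_1 - (R_2 / R_1)^2], and this persists at [y = z] when
    [R_m(z)] is read as [psi^(m)(z) / m!].  Being [O((y - z)^k)] perturbations of
    polynomials, the [R_m] have second order jets at [z] given by the next Taylor
    coefficients, so both diagonal Schwarzians become explicit rational functions of
    [psi'(z), ..., psi^(5)(z)], and the claim is an identity between them.
    Smoothness of [psi] comes from termwise differentiation of its Laurent expansion. *)

(** The formulas come from moving the base point. With [y] fixed and [w] in place of [z], one has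
    [d_w R_m = m R_(m+1)]. The difference quotient [D] is [R_1], so its first two [w]-derivatives
    are [R_2] and [2 R_3]; the rest is [(log D)' = D'/D] and [(log D)'' = D''/D - (D'/D)^2].

    The obstacle is the point [y = z]. The outer derivatives are taken exactly there, while the
    closed form of [R_m] has a removable singularity of order [m]. It is not enough to know the
    limit: [R_m] has to be twice differentiable across the singularity, with known coefficients.
    This is why vanishing orders are tracked quantitatively, and why Taylor polynomials with three
    more terms than the power divided out are used.

    The nonvanishing of [psi'] and of [psi y - psi z], which all these quotients require, is read
    off from values of the exponential. The fifth derivative appears because [R_3] has to be
    expanded to second order; the constants 1/5 and 6/5 are what the factorials up to 5! leave. *)

Notation nearC := (locally (T := AbsRing_UniformSpace C_AbsRing)).

(** * Complex derivatives *)

Definition Cder (f : C -> C) (z l : C) : Prop :=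
  is_derive (K := C_AbsRing) (V := C_NormedModule) f z l.

Lemma locally_Cmod (z : C) (P : C -> Prop) :
  nearC z P <->
  exists d : R, (0 < d)%R /\ forall y : C, (Cmod (y - z) < d)%R -> P y.
Proof.
  split.
  - intros [d Hd]; exists d; split; [apply cond_pos | intros y Hy; apply Hd, Hy].
  - intros [d [Hd H]]; exists (mkposreal d Hd); intros y Hy; apply H, Hy.
Qed.

Lemma Cder_eps (f : C -> C) (z l : C) :
  Cder f z l <->
  forall e : R, (0 < e)%R -> exists d : R, (0 < d)%R /\
    forall y : C, (Cmod (y - z) < d)%R ->
      (Cmod (f y - f z - l * (y - z)) <= e * Cmod (y - z))%R.
Proof.
  split.
  - intros [_ H] e He.
    specialize (H z (fun P HP => HP) (mkposreal e He)).
    apply locally_Cmod in H; destruct H as [d [Hd H]].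
    exists d; split; [exact Hd | intros y Hy].
    specialize (H y Hy). rewrite Cmult_comm. exact H.
  - intros H; split; [apply is_linear_scal_l |].
    intros x Hx.
    rewrite <- (is_filter_lim_locally_unique (K := C_AbsRing) (V := AbsRing_NormedModule C_AbsRing) _ _ Hx).
    intros e.
    apply locally_Cmod; destruct (H e (cond_pos e)) as [d [Hd Hd']].
    exists d; split; [exact Hd | intros y Hy].
    specialize (Hd' y Hy). rewrite Cmult_comm in Hd'. exact Hd'.
Qed.

Lemma Cder_eq (f : C -> C) (z l l' : C) : Cder f z l -> l = l' -> Cder f z l'.
Proof. intros H <-; exact H. Qed.

Lemma Cder_ext (f g : C -> C) (z l : C) :
  (forall t, f t = g t) -> Cder f z l -> Cder g z l.
Proof. apply (is_derive_ext (K := C_AbsRing) (V := C_NormedModule)). Qed.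

Lemma Cder_const (c z : C) : Cder (fun _ => c) z 0.
Proof. apply (is_derive_const (K := C_AbsRing) (V := C_NormedModule)). Qed.

Lemma Cder_id (z : C) : Cder (fun y => y) z 1.
Proof.
  apply (proj2 (Cder_eps _ _ _)); intros e He; exists 1%R; split; [lra | intros y _].
  replace (y - z - 1 * (y - z)) with (RtoC 0) by ring.
  rewrite Cmod_0; apply Rmult_le_pos; [lra | apply Cmod_ge_0].
Qed.

Lemma Cder_plus (f g : C -> C) (z a b : C) :
  Cder f z a -> Cder g z b -> Cder (fun y => f y + g y) z (a + b).
Proof. apply (is_derive_plus (K := C_AbsRing) (V := C_NormedModule)). Qed.

Lemma Cder_opp (f : C -> C) (z a : C) :
  Cder f z a -> Cder (fun y => - f y) z (- a).
Proof. apply (is_derive_opp (K := C_AbsRing) (V := C_NormedModule)). Qed.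

Lemma Cder_minus (f g : C -> C) (z a b : C) :
  Cder f z a -> Cder g z b -> Cder (fun y => f y - g y) z (a - b).
Proof. apply (is_derive_minus (K := C_AbsRing) (V := C_NormedModule)). Qed.

Lemma Cder_comp (f g : C -> C) (z a b : C) :
  Cder f (g z) a -> Cder g z b -> Cder (fun y => f (g y)) z (a * b).
Proof.
  intros Hf Hg; rewrite Cmult_comm.
  (* The library rule wants the inner derivative in [AbsRing_NormedModule C_AbsRing], so [Hg] is
     transported through its epsilon form. *)
  apply (is_derive_comp (K := C_AbsRing) (V := C_NormedModule)); [exact Hf |].
  rewrite Cder_eps in Hg.
  split; [apply is_linear_scal_l |].
  intros x Hx.
  rewrite <- (is_filter_lim_locally_unique (K := C_AbsRing) (V := AbsRing_NormedModule C_AbsRing) _ _ Hx).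
  intros e.
  apply locally_Cmod; destruct (Hg e (cond_pos e)) as [d [Hd Hd']].
  exists d; split; [exact Hd | intros y Hy].
  specialize (Hd' y Hy). rewrite Cmult_comm in Hd'. exact Hd'.
Qed.

Lemma Cder_continuous (f : C -> C) (z l : C) :
  Cder f z l -> forall e : R, (0 < e)%R -> exists d : R, (0 < d)%R /\
    forall y : C, (Cmod (y - z) < d)%R -> (Cmod (f y - f z) < e)%R.
Proof.
  intros H e He; rewrite Cder_eps in H.
  destruct (H 1%R Rlt_0_1) as [d [Hd Hd']].
  pose proof (Cmod_ge_0 l) as Hl.
  assert (Hk : (0 < 1 + Cmod l)%R) by lra.
  exists (Rmin d (e / (1 + Cmod l))); split.
  - apply Rmin_pos; [exact Hd | apply Rdiv_lt_0_compat; lra].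
  - intros y Hy.
    assert (H1 : (Cmod (y - z) < d)%R) by (eapply Rlt_le_trans; [exact Hy | apply Rmin_l]).
    assert (H2 : (Cmod (y - z) < e / (1 + Cmod l))%R)
      by (eapply Rlt_le_trans; [exact Hy | apply Rmin_r]).
    apply Hd' in H1.
    replace (f y - f z) with ((f y - f z - l * (y - z)) + l * (y - z)) by ring.
    eapply Rle_lt_trans; [apply Cmod_triangle |].
    rewrite Cmod_mult.
    apply (Rmult_lt_compat_r (1 + Cmod l)) in H2; [| exact Hk].
    unfold Rdiv in H2; rewrite Rmult_assoc, Rinv_l, Rmult_1_r in H2; [| lra].
    lra.
Qed.

Lemma Cder_sqr (z : C) : Cder (fun y => y * y) z (2 * z).
Proof.
  apply (proj2 (Cder_eps _ _ _)); intros e He; exists e; split; [exact He | intros y Hy].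
  replace (y * y - z * z - 2 * z * (y - z)) with ((y - z) * (y - z)) by ring.
  rewrite Cmod_mult; apply Rmult_le_compat_r; [apply Cmod_ge_0 | lra].
Qed.

Lemma Cder_scal (c : C) (f : C -> C) (z a : C) :
  Cder f z a -> Cder (fun y => c * f y) z (c * a).
Proof.
  intros H.
  apply (proj2 (Cder_eps _ _ _)); intros e He.
  rewrite Cder_eps in H.
  pose proof (Cmod_ge_0 c).
  destruct (H (e / (1 + Cmod c))%R) as [d [Hd Hd']]; [apply Rdiv_lt_0_compat; lra |].
  exists d; split; [exact Hd | intros y Hy].
  replace (c * f y - c * f z - c * a * (y - z)) with (c * (f y - f z - a * (y - z))) by ring.
  rewrite Cmod_mult.
  eapply Rle_trans; [apply Rmult_le_compat_l; [lra | apply Hd', Hy] |].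
  rewrite <- Rmult_assoc; apply Rmult_le_compat_r; [apply Cmod_ge_0 |].
  apply (Rmult_le_reg_r (1 + Cmod c)); [lra |].
  replace (Cmod c * (e / (1 + Cmod c)) * (1 + Cmod c))%R with (Cmod c * e)%R by (field; lra).
  nra.
Qed.

(* Polarisation: [f g = ((f + g)^2 - f^2 - g^2) / 2]. *)
Lemma Cder_mult (f g : C -> C) (z a b : C) :
  Cder f z a -> Cder g z b ->
  Cder (fun y => f y * g y) z (a * g z + f z * b).
Proof.
  intros Hf Hg.
  pose proof (Cder_plus _ _ _ _ _ Hf Hg) as Hs.
  pose proof (Cder_comp (fun x => x * x) (fun y => f y + g y) z _ _ (Cder_sqr (f z + g z)) Hs) as H1.
  pose proof (Cder_comp (fun x => x * x) f z _ _ (Cder_sqr (f z)) Hf) as H2.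
  pose proof (Cder_comp (fun x => x * x) g z _ _ (Cder_sqr (g z)) Hg) as H3.
  pose proof (Cder_scal (/ 2) _ _ _ (Cder_minus _ _ _ _ _ (Cder_minus _ _ _ _ _ H1 H2) H3)) as H.
  eapply Cder_eq.
  - eapply Cder_ext; [| exact H]; intros t; cbn beta.
    field.
  - cbn beta. field.
Qed.

Lemma Cder_inv (z : C) : z <> 0 -> Cder (fun y => / y) z (- / (z * z)).
Proof.
  intros Hz.
  assert (Hm : (0 < Cmod z)%R) by (apply Cmod_gt_0, Hz).
  set (m := Cmod z) in *.
  apply (proj2 (Cder_eps _ _ _)); intros e He.
  (* The error is [(y - z)^2 / (y z^2)]. The first bound keeps [Cmod y] above [m / 2], so the error
     is at most [2 |y - z|^2 / m^3], which the second bound makes at most [e |y - z|]. *)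
  exists (Rmin (m / 2) (e * (m * m * m) / 2)); split.
  - apply Rmin_pos; [lra |]. apply Rdiv_lt_0_compat; [| lra].
    repeat apply Rmult_lt_0_compat; lra.
  - intros y Hy.
    assert (H1 : (Cmod (y - z) < m / 2)%R) by (eapply Rlt_le_trans; [exact Hy | apply Rmin_l]).
    assert (H2 : (Cmod (y - z) < e * (m * m * m) / 2)%R)
      by (eapply Rlt_le_trans; [exact Hy | apply Rmin_r]).
    assert (Hy2 : (m / 2 < Cmod y)%R).
    { assert (m <= Cmod y + Cmod (y - z))%R; [| lra].
      unfold m; replace z with (y + - (y - z)) at 1 by ring.
      eapply Rle_trans; [apply Cmod_triangle |]. rewrite Cmod_opp; lra. }
    assert (Hy0 : y <> 0) by (apply Cmod_gt_0; lra).
    replace (/ y - / z - - / (z * z) * (y - z))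
      with ((y - z) * ((y - z) / (y * (z * z)))) by (field; auto).
    rewrite Cmod_mult, Rmult_comm; apply Rmult_le_compat_r; [apply Cmod_ge_0 |].
    rewrite Cmod_div by (repeat apply Cmult_neq_0; auto).
    rewrite !Cmod_mult. fold m.
    apply (Rmult_le_reg_r (Cmod y * (m * m))); [repeat apply Rmult_lt_0_compat; lra |].
    unfold Rdiv; rewrite Rmult_assoc, Rinv_l, Rmult_1_r;
      [| apply Rgt_not_eq; repeat apply Rmult_lt_0_compat; lra].
    assert (m / 2 * (m * m) <= Cmod y * (m * m))%R by (apply Rmult_le_compat_r; nra).
    assert (e * (m / 2 * (m * m)) <= e * (Cmod y * (m * m)))%R by (apply Rmult_le_compat_l; lra).
    lra.
Qed.

Lemma Cder_inv_fct (f : C -> C) (z a : C) :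
  f z <> 0 -> Cder f z a -> Cder (fun y => / f y) z (- a / (f z * f z)).
Proof.
  intros H0 H.
  eapply Cder_eq; [apply (Cder_comp (fun y => / y) f z); [apply Cder_inv, H0 | exact H] |].
  cbn beta; field; exact H0.
Qed.

Lemma Cder_ext_loc (f g : C -> C) (z l : C) :
  nearC z (fun y => f y = g y) ->
  Cder f z l -> Cder g z l.
Proof. apply (is_derive_ext_loc (K := C_AbsRing) (V := C_NormedModule)). Qed.

Lemma Cder_pow (n : nat) (z : C) : Cder (fun y => y ^ S n) z (INR (S n) * z ^ n).
Proof.
  induction n as [|n IH].
  - eapply Cder_eq; [eapply Cder_ext; [| apply Cder_id] | simpl; ring].
    intros t. simpl; ring.
  - eapply Cder_eq; [exact (Cder_mult _ _ _ _ _ (Cder_id z) IH) |].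
    cbn beta. rewrite (S_INR (S n)), RtoC_plus.
    change (z ^ S n) with (z * z ^ n). ring.
Qed.

(** * Laurent series *)

Definition Cser (a : nat -> C) (l : C) : Prop :=
  is_series (K := C_AbsRing) (V := C_NormedModule) a l.

Lemma Cser_ext (a b : nat -> C) (l : C) :
  (forall n, a n = b n) -> Cser a l -> Cser b l.
Proof. apply (is_series_ext (K := C_AbsRing) (V := C_NormedModule)). Qed.

Lemma Cser_scal (c : C) (a : nat -> C) (l : C) :
  Cser a l -> Cser (fun n => c * a n) (c * l).
Proof. apply (is_series_scal (K := C_AbsRing) (V := C_NormedModule)). Qed.

Lemma Cser_minus (a b : nat -> C) (la lb : C) :
  Cser a la -> Cser b lb -> Cser (fun n => a n - b n) (la - lb).
Proof. apply (is_series_minus (K := C_AbsRing) (V := C_NormedModule)). Qed.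

Lemma Cser_incr_1 (a : nat -> C) (l : C) :
  Cser a l -> Cser (fun n => a (S n)) (l - a 0%nat).
Proof.
  intros H; apply (is_series_incr_1 (K := C_AbsRing) (V := C_NormedModule)).
  assert (E : l = (l - a 0%nat) + a 0%nat) by ring.
  rewrite E in H; exact H.
Qed.

Lemma Cser_decr_1 (a : nat -> C) (l : C) :
  Cser (fun n => a (S n)) (l - a 0%nat) -> Cser a l.
Proof. apply (is_series_decr_1 (K := C_AbsRing) (V := C_NormedModule)). Qed.

Lemma Cser_bounded (a : nat -> C) (l : C) :
  Cser a l -> exists M : R, forall n, (Cmod (a n) <= M)%R.
Proof.
  intros H.
  destruct (filterlim_bounded (K := C_AbsRing) (V := C_NormedModule)
              (sum_n (G := C_NormedModule) a) (ex_intro _ l H)) as [M HM].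
  exists (M + M)%R; intros [|n].
  - specialize (HM 0%nat); rewrite sum_O in HM.
    change (Cmod (a 0%nat) <= M)%R in HM. pose proof (Cmod_ge_0 (a 0%nat)); lra.
  - pose proof (HM n) as H1; pose proof (HM (S n)) as H2.
    rewrite sum_Sn in H2.
    set (s := sum_n (G := C_NormedModule) a n) in *.
    change (Cmod s <= M)%R in H1. change (Cmod (s + a (S n)) <= M)%R in H2.
    replace (a (S n)) with ((s + a (S n)) + - s) by ring.
    eapply Rle_trans; [apply Cmod_triangle |]. rewrite Cmod_opp; lra.
Qed.

Lemma Cser_le (a : nat -> C) (c : nat -> R) (l : C) (s : R) :
  (forall n, (Cmod (a n) <= c n)%R) -> Cser a l -> is_series c s -> (Cmod l <= s)%R.
Proof.
  intros Hle Ha Hc.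
  assert (Hn : filterlim (fun n => Cmod (sum_n (G := C_NormedModule) a n))
                 eventually (locally (Cmod l))).
  { eapply filterlim_comp; [exact Ha |].
    apply (filterlim_norm (K := C_AbsRing) (V := C_NormedModule)). }
  refine (filterlim_le _ _ (Finite (Cmod l)) (Finite s) _ Hn Hc).
  exists 0%nat; intros n _.
  eapply Rle_trans; [apply (norm_sum_n_m (K := C_AbsRing) (V := C_NormedModule)) |].
  apply sum_n_m_le; exact Hle.
Qed.

Lemma Cser_dominated (a : nat -> C) (c : nat -> R) :
  (forall n, (Cmod (a n) <= c n)%R) -> ex_series c -> exists l, Cser a l.
Proof.
  intros H Hc.
  exact (ex_series_le (K := C_AbsRing) (V := C_CompleteNormedModule) a c H Hc).
Qed.

(** * Termwise differentiation of power series *)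

Definition pow_rem (u v : C) (n : nat) : C :=
  u ^ n - v ^ n - INR n * v ^ pred n * (u - v).

Lemma pow_rem_SS (u v : C) (n : nat) :
  pow_rem u v (S (S n)) =
  u * pow_rem u v (S n) + INR (S n) * v ^ n * ((u - v) * (u - v)).
Proof.
  unfold pow_rem.
  change (pred (S (S n))) with (S n). change (pred (S n)) with n.
  rewrite (S_INR (S n)), RtoC_plus, !Cpow_S. ring.
Qed.

(** Induction along [pow_rem_SS], where the constant needed is [(n+1)(n+2) + (n+2) = (n+2)^2 <=
    (n+2)(n+3)]. The bound is twice the sharp one, so that its coefficients are those of a power
    series differentiated twice. *)
Lemma pow_rem_le (u v : C) (r : R) (n : nat) :
  (Cmod u <= r)%R -> (Cmod v <= r)%R ->
  (Cmod (pow_rem u v (S (S n))) <=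
   INR (S n) * INR (S (S n)) * r ^ n * (Cmod (u - v) * Cmod (u - v)))%R.
Proof.
  intros Hu Hv.
  assert (Hr : (0 <= r)%R) by (pose proof (Cmod_ge_0 u); lra).
  assert (Hd : (0 <= Cmod (u - v) * Cmod (u - v))%R)
    by (apply Rmult_le_pos; apply Cmod_ge_0).
  assert (Hvn : forall k, (Cmod (v ^ k) <= r ^ k)%R).
  { intros k; rewrite Cmod_pow; apply pow_incr; split; [apply Cmod_ge_0 | exact Hv]. }
  induction n as [|n IH].
  - replace (pow_rem u v 2) with ((u - v) * (u - v)).
    + rewrite Cmod_mult; simpl; lra.
    + unfold pow_rem; simpl. rewrite RtoC_plus. ring.
  - rewrite pow_rem_SS.
    eapply Rle_trans; [apply Cmod_triangle |].
    rewrite !Cmod_mult, Cmod_R, (Rabs_pos_eq (INR _)) by apply pos_INR.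
    set (D := (Cmod (u - v) * Cmod (u - v))%R) in *.
    apply Rle_trans with
      (r * (INR (S n) * INR (S (S n)) * r ^ n * D) + INR (S (S n)) * r ^ S n * D)%R.
    + apply Rplus_le_compat.
      * apply Rmult_le_compat; auto using Cmod_ge_0.
      * apply Rmult_le_compat_r; [exact Hd |].
        apply Rmult_le_compat_l; [apply pos_INR | apply Hvn].
    + rewrite (S_INR (S (S n))), (S_INR (S n)).
      pose proof (pos_INR (S n)) as Hp.
      assert (0 <= r ^ S n * D)%R by (apply Rmult_le_pos; [apply pow_le |]; assumption).
      replace (r * (INR (S n) * (INR (S n) + 1) * r ^ n * D) + (INR (S n) + 1) * r ^ S n * D)%R
        with ((INR (S n) + 1) * (INR (S n) + 1) * (r ^ S n * D))%R by (simpl pow; ring).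
      replace ((INR (S n) + 1) * (INR (S n) + 1 + 1) * r ^ S n * D)%R
        with ((INR (S n) + 1) * (INR (S n) + 1 + 1) * (r ^ S n * D))%R by ring.
      apply Rmult_le_compat_r; [assumption |]. nra.
Qed.

(** Convergence at the midpoint [rho] of [r] and 1 bounds [|b n| rho^n], so the real series with
    coefficients [|b n|] has radius of convergence at least [rho > r], and differentiation does not
    change the radius. *)
Lemma ex_series_second_derived (b : nat -> C) (r : R) :
  (0 <= r < 1)%R ->
  (forall u : C, (Cmod u < 1)%R -> exists l, Cser (fun n => b n * u ^ n) l) ->
  ex_series (fun n => INR (S n) * INR (S (S n)) * Cmod (b (S (S n))) * r ^ n)%R /\
  ex_series (fun n => INR (S n) * Cmod (b (S n)) * r ^ n)%R.
Proof.
  intros Hr Hb.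
  set (a := fun n => Cmod (b n)).
  assert (Hrad : Rbar_lt (Rabs r) (CV_radius a)).
  { set (rho := ((1 + r) / 2)%R).
    apply Rbar_lt_le_trans with (Finite rho).
    - rewrite Rabs_pos_eq by lra. unfold rho; simpl; lra.
    - destruct (Hb (RtoC rho)) as [l Hl].
      { rewrite Cmod_R, Rabs_pos_eq; unfold rho; lra. }
      apply Cser_bounded in Hl; destruct Hl as [M HM].
      apply (proj1 (CV_radius_bounded a)).
      exists M; intros n; specialize (HM n).
      rewrite Cmod_mult, Cmod_pow, Cmod_R in HM.
      unfold a; rewrite Rabs_mult, (Rabs_pos_eq (Cmod _)) by apply Cmod_ge_0.
      rewrite <- RPow_abs. exact HM. }
  split.
  - assert (H : ex_pseries (PS_derive (PS_derive a)) r).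
    { apply ex_pseries_derive. rewrite CV_radius_derive; exact Hrad. }
    apply ex_pseries_R in H. revert H; apply ex_series_ext; intros n.
    unfold PS_derive, a.
    match goal with |- @eq _ ?x ?y => change (@eq R x y) end; ring.
  - assert (H : ex_pseries (PS_derive a) r) by (apply ex_pseries_derive, Hrad).
    apply ex_pseries_R in H. revert H; apply ex_series_ext; intros n.
    unfold PS_derive, a.
    match goal with |- @eq _ ?x ?y => change (@eq R x y) end; ring.
Qed.

(** Summing [pow_rem_le] over the series gives [|f u - f v - l (u - v)| <= S2 |u - v|^2] on the disc
    of radius [r], with [S2] the sum of the twice differentiated majorant. A quadratic error gives
    the derivative. *)
Lemma Cder_power_series (b : nat -> C) (f : C -> C) :
  (forall u : C, (Cmod u < 1)%R -> Cser (fun n => b n * u ^ n) (f u)) ->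
  forall v : C, (Cmod v < 1)%R -> exists l : C,
    Cser (fun n => INR (S n) * b (S n) * v ^ n) l /\ Cder f v l.
Proof.
  intros Hf v Hv.
  set (r := ((1 + Cmod v) / 2)%R).
  pose proof (Cmod_ge_0 v) as Hv0.
  assert (Hr : (0 <= r < 1)%R) by (unfold r; lra).
  destruct (ex_series_second_derived b r Hr) as [[S2 HS2] HS1].
  { intros u Hu; exists (f u); apply Hf, Hu. }
  destruct (Cser_dominated (fun n => INR (S n) * b (S n) * v ^ n)
              (fun n => INR (S n) * Cmod (b (S n)) * r ^ n)%R) as [l Hl].
  { intros n. rewrite !Cmod_mult, Cmod_R, Cmod_pow, (Rabs_pos_eq (INR _)) by apply pos_INR.
    apply Rmult_le_compat_l; [apply Rmult_le_pos; [apply pos_INR | apply Cmod_ge_0] |].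
    apply pow_incr; unfold r; lra. }
  { exact HS1. }
  exists l; split; [exact Hl |].
  assert (HS2p : (0 <= S2)%R).
  { eapply Rle_trans; [apply (Cmod_ge_0 (RtoC 0)) |].
    eapply (Cser_le (fun _ => RtoC 0)); [| | exact HS2].
    - intros n; rewrite Cmod_0. repeat apply Rmult_le_pos; try apply pos_INR; try apply Cmod_ge_0.
      apply pow_le; lra.
    (* The zero series is obtained as a convergent series minus itself. *)
    - assert (Z : Cser (fun n => b n * v ^ n - b n * v ^ n) (f v - f v))
        by (apply Cser_minus; apply Hf, Hv).
      replace (f v - f v) with (RtoC 0) in Z by ring.
      revert Z; apply Cser_ext; intros n; ring. }
  assert (Hest : forall u, (Cmod u <= r)%R ->
            (Cmod (f u - f v - l * (u - v)) <= S2 * (Cmod (u - v) * Cmod (u - v)))%R).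
  { intros u Hu.
    assert (Hu1 : (Cmod u < 1)%R) by lra.
    assert (Hsum : Cser (fun n => b n * pow_rem u v n) (f u - f v - l * (u - v))).
    { pose proof (Cser_minus _ _ _ _ (Hf u Hu1) (Hf v Hv)) as H1.
      (* The derivative series is shifted to run alongside [b n * u ^ n]; the new term at [n = 0]
         vanishes through its factor [INR 0]. *)
      assert (H2 : Cser (fun n => (u - v) * (INR n * b n * v ^ pred n)) ((u - v) * l)).
      { apply Cser_scal, Cser_decr_1. simpl INR.
        replace (l - 0 * b 0%nat * v ^ pred 0) with l by ring. exact Hl. }
      pose proof (Cser_minus _ _ _ _ H1 H2) as H3.
      replace (f u - f v - l * (u - v)) with (f u - f v - (u - v) * l) by ring.
      revert H3; apply Cser_ext; intros n; unfold pow_rem; ring. }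
    apply Cser_incr_1, Cser_incr_1 in Hsum.
    replace (f u - f v - l * (u - v) - b 0%nat * pow_rem u v 0 - b 1%nat * pow_rem u v 1)
      with (f u - f v - l * (u - v)) in Hsum by (unfold pow_rem; simpl; ring).
    eapply Cser_le; [| exact Hsum | apply (is_series_scal_r (Cmod (u - v) * Cmod (u - v))), HS2].
    intros n; simpl. rewrite Cmod_mult.
    assert (Hv' : (Cmod v <= r)%R) by (unfold r; lra).
    eapply Rle_trans; [apply Rmult_le_compat_l; [apply Cmod_ge_0 | apply (pow_rem_le u v r n Hu Hv')] |].
    apply Req_le. simpl. ring. }
  apply Cder_eps; intros e He.
  exists (Rmin ((1 - Cmod v) / 2) (e / (1 + S2))); split.
  - apply Rmin_pos; [lra | apply Rdiv_lt_0_compat; lra].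
  - intros u Hu.
    assert (H1 : (Cmod (u - v) < (1 - Cmod v) / 2)%R) by (eapply Rlt_le_trans; [exact Hu | apply Rmin_l]).
    assert (H2 : (Cmod (u - v) < e / (1 + S2))%R) by (eapply Rlt_le_trans; [exact Hu | apply Rmin_r]).
    assert (Hur : (Cmod u <= r)%R).
    { replace u with (v + (u - v)) by ring.
      eapply Rle_trans; [apply Cmod_triangle |]. unfold r; lra. }
    eapply Rle_trans; [apply Hest, Hur |].
    rewrite <- Rmult_assoc; apply Rmult_le_compat_r; [apply Cmod_ge_0 |].
    apply (Rmult_lt_compat_r (1 + S2)) in H2; [| lra].
    replace (e / (1 + S2) * (1 + S2))%R with e in H2 by (field; lra).
    pose proof (Cmod_ge_0 (u - v)). nra.
Qed.

Definition laurent_on_De (g : C -> C) : Prop :=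
  exists b : nat -> C, forall z, De z -> Cser (fun n => b n * / z ^ n) (g z).

Lemma De_neq_0 (z : C) : De z -> z <> 0.
Proof. intros H; apply Cmod_gt_0; unfold De in H; lra. Qed.

Lemma De_inv (z : C) : De z -> (Cmod (/ z) < 1)%R.
Proof.
  intros H; rewrite Cmod_inv by (apply De_neq_0, H).
  rewrite <- Rinv_1; apply Rinv_lt_contravar; unfold De in H; lra.
Qed.

Lemma De_locally (z : C) : De z -> nearC z De.
Proof.
  intros H; apply locally_Cmod; unfold De in *.
  exists (Cmod z - 1)%R; split; [lra | intros y Hy].
  assert (Cmod z <= Cmod y + Cmod (y - z))%R; [| lra].
  replace z with (y + - (y - z)) at 1 by ring.
  eapply Rle_trans; [apply Cmod_triangle |]. rewrite Cmod_opp; lra.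
Qed.

(** The substitution [u = 1 / z] turns the expansion into a power series on the unit disc. The chain
    rule factor [-1 / z^2] shifts the coefficients by two, so the class of such expansions is closed
    under differentiation and the lemma can be iterated. *)
Lemma laurent_derive (g : C -> C) :
  laurent_on_De g ->
  (forall z, De z -> Cder g z (C_derive g z)) /\ laurent_on_De (C_derive g).
Proof.
  intros [b Hb].
  (* The value at [u = 0] is that of the expansion at infinity; with it [f] is the sum of the power
     series on the whole disc. *)
  set (f := fun u => if Ceq_dec u 0 then b 0%nat else g (/ u)).
  assert (Hf : forall u : C, (Cmod u < 1)%R -> Cser (fun n => b n * u ^ n) (f u)).
  { intros u Hu; unfold f; destruct (Ceq_dec u 0) as [-> | Hu0].
    - apply Cser_decr_1.
      replace (b 0%nat - b 0%nat * 0 ^ 0) with (0 * b 0%nat) by (simpl; ring).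
      (* At [u = 0] all terms after the constant one are zero; the zero series is 0 times the
         expansion at the arbitrary point 2. *)
      assert (Z := Cser_scal 0 _ _ (Hb (RtoC 2) ltac:(unfold De; rewrite Cmod_R, Rabs_pos_eq; lra))).
      replace (0 * b 0%nat) with (0 * g 2) by ring.
      revert Z; apply Cser_ext; intros n; rewrite Cpow_S; ring.
    - assert (HD : De (/ u)).
      { unfold De; rewrite Cmod_inv by exact Hu0.
        rewrite <- Rinv_1; apply Rinv_lt_contravar; [| exact Hu].
        apply Cmod_gt_0 in Hu0; lra. }
      generalize (Hb _ HD); apply Cser_ext; intros n.
      rewrite Cpow_inv by exact Hu0. f_equal. field. apply Cpow_nz, Hu0. }
  assert (Hg : forall z, De z -> g z = f (/ z)).
  { intros z Hz; unfold f; destruct (Ceq_dec (/ z) 0) as [E | _].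
    - exfalso; apply (De_neq_0 _ Hz).
      assert (z * / z = 1) by (field; apply De_neq_0, Hz).
      rewrite E in H; exfalso; apply C1_nz. rewrite <- H; ring.
    - f_equal; field; apply De_neq_0, Hz. }
  assert (Hd : forall z, De z -> exists l,
             Cser (fun n => INR (S n) * b (S n) * (/ z) ^ n) l /\ Cder g z (- l / (z * z))).
  { intros z Hz.
    destruct (Cder_power_series b f Hf (/ z) (De_inv z Hz)) as [l [H1 H2]].
    exists l; split; [exact H1 |].
    apply Cder_ext_loc with (fun y => f (/ y)).
    - eapply filter_imp; [| apply De_locally, Hz].
      intros y Hy; symmetry; apply Hg, Hy.
    - eapply Cder_eq; [apply (Cder_comp f (fun y => / y) z l); [exact H2 | apply Cder_inv, De_neq_0, Hz] |].
      field; apply De_neq_0, Hz. }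
  split.
  - intros z Hz; destruct (Hd z Hz) as [l [_ H]].
    rewrite (is_C_derive_unique _ _ _ H); exact H.
  (* The derivative of [b_k z^(-k)] is [-k b_k z^(-k-1)]: index [k = m + 1] moves to [m + 2]. *)
  - exists (fun n => match n with S (S m) => - (INR (S m) * b (S m)) | _ => RtoC 0 end).
    intros z Hz; destruct (Hd z Hz) as [l [H1 H]].
    rewrite (is_C_derive_unique _ _ _ H).
    apply Cser_decr_1, Cser_decr_1.
    replace (- l / (z * z) - 0 * / z ^ 0 - 0 * / z ^ 1) with (- / (z * z) * l)
      by (field; apply De_neq_0, Hz).
    apply (Cser_scal (- / (z * z))) in H1. revert H1; apply Cser_ext; intros n.
    pose proof (De_neq_0 z Hz) as Hz0.
    rewrite Cpow_inv, !Cpow_S by exact Hz0.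
    field; split; [apply Cpow_nz |]; exact Hz0.
Qed.

(** The leading term [z] keeps [psi] itself out of [laurent_on_De]. However, [psi'] is the
    derivative of [psi z - z] plus 1, which only alters the constant coefficient, and
    [laurent_derive] then covers all higher derivatives. *)
Lemma Sigma_derive_n (psi : C -> C) :
  Sigma psi -> forall k z, De z ->
  Cder (C_derive_n k psi) z (C_derive_n (S k) psi z).
Proof.
  intros [Hhol [_ [b Hb]]].
  assert (H0 : forall z, De z -> Cder psi z (C_derive psi z)).
  { intros z Hz; apply C_derive_correct; [exact z | apply Hhol, Hz]. }
  assert (H1 : laurent_on_De (fun z => psi z - z)) by (exists b; exact Hb).
  destruct (laurent_derive _ H1) as [H2 [c Hc]].
  assert (H3 : laurent_on_De (C_derive psi)).
  { exists (fun n => match n with O => c 0%nat + 1 | _ => c n end).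
    intros z Hz.
    assert (E : C_derive psi z = C_derive (fun z => psi z - z) z + 1).
    { apply is_C_derive_unique.
      apply (Cder_ext (fun y => (psi y - y) + y)); [intros t; ring |].
      apply Cder_plus; [apply H2, Hz | apply Cder_id]. }
    rewrite E. specialize (Hc z Hz).
    apply Cser_decr_1. apply Cser_incr_1 in Hc.
    match goal with |- Cser _ ?x => match type of Hc with Cser _ ?y => replace x with y by (simpl; field) end end.
    revert Hc; apply Cser_ext; intros n; reflexivity. }
  assert (H4 : forall k, laurent_on_De (C_derive_n (S k) psi)).
  { intros k; induction k as [|k IH]; [exact H3 | apply laurent_derive, IH]. }
  intros [|k] z Hz; [apply H0, Hz | apply (laurent_derive _ (H4 k)), Hz].
Qed.

(** * Taylor remainders and second order jets *)

(** The bound includes the point [y = z]: for positive order it forces [f z = 0], which fits the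
    convention that a quotient with numerator 0 is 0. *)
Definition flat (n : nat) (f : C -> C) (z : C) : Prop :=
  exists K : R, (0 <= K)%R /\
    nearC z (fun y => (Cmod (f y) <= K * Cmod (y - z) ^ n)%R).

Lemma flat_at (n : nat) (f : C -> C) (z : C) : flat (S n) f z -> f z = 0.
Proof.
  intros [K [_ H]]; apply locally_Cmod in H; destruct H as [d [Hd H]].
  assert (E : z - z = 0) by ring.
  specialize (H z); rewrite E, Cmod_0 in H; specialize (H Hd).
  apply Cmod_eq_0. simpl in H. pose proof (Cmod_ge_0 (f z)). lra.
Qed.

Lemma flat_minus (n : nat) (f g : C -> C) (z : C) :
  flat n f z -> flat n g z -> flat n (fun y => f y - g y) z.
Proof.
  intros [K [HK Hf]] [L [HL Hg]]; exists (K + L)%R; split; [lra |].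
  eapply filter_imp; [| exact (filter_and _ _ Hf Hg)]; intros y [H1 H2].
  eapply Rle_trans; [apply Cmod_triangle |]. rewrite Cmod_opp; lra.
Qed.

Lemma flat_scal (n : nat) (c : C) (f : C -> C) (z : C) :
  flat n f z -> flat n (fun y => c * f y) z.
Proof.
  intros [K [HK Hf]]; exists (Cmod c * K)%R.
  split; [apply Rmult_le_pos; [apply Cmod_ge_0 | exact HK] |].
  eapply filter_imp; [| exact Hf]; intros y H.
  rewrite Cmod_mult, Rmult_assoc; apply Rmult_le_compat_l; [apply Cmod_ge_0 | exact H].
Qed.

(* At [y = z] the quotient is [0 * / 0 = 0], so no case distinction is needed. *)
Lemma flat_div (n m : nat) (f : C -> C) (z : C) :
  flat (S n + m) f z -> flat (S n) (fun y => f y / (y - z) ^ m) z.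
Proof.
  intros H0; pose proof (flat_at _ _ _ H0) as Hz; destruct H0 as [K [HK Hf]].
  exists K; split; [exact HK |].
  eapply filter_imp; [| exact Hf]; intros y H.
  destruct (Ceq_dec y z) as [-> | Hy].
  - rewrite Hz; unfold Cdiv; rewrite Cmult_0_l, Cmod_0.
    apply Rmult_le_pos; [exact HK | apply pow_le, Cmod_ge_0].
  - assert (Hh : y - z <> 0).
    { intros E; apply Hy. replace y with ((y - z) + z) by ring. rewrite E; ring. }
    rewrite Cmod_div by (apply Cpow_nz, Hh). rewrite Cmod_pow.
    apply Cmod_gt_0 in Hh.
    assert (Hp : (0 < Cmod (y - z) ^ m)%R) by (apply pow_lt, Hh).
    apply (Rmult_le_reg_r (Cmod (y - z) ^ m)); [exact Hp |].
    unfold Rdiv; rewrite Rmult_assoc, Rinv_l, Rmult_1_r by lra.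
    rewrite Rmult_assoc, <- pow_add; exact H.
Qed.

Lemma flat_pred (n : nat) (f : C -> C) (z : C) : flat (S n) f z -> flat n f z.
Proof.
  intros [K [HK Hf]]; exists K; split; [exact HK |].
  assert (H1 : nearC z (fun y => (Cmod (y - z) < 1)%R))
    by (apply locally_Cmod; exists 1%R; split; [lra | auto]).
  eapply filter_imp; [| exact (filter_and _ _ Hf H1)]; intros y [H H2].
  eapply Rle_trans; [exact H |]. apply Rmult_le_compat_l; [exact HK |].
  simpl. assert (0 <= Cmod (y - z) ^ n)%R by (apply pow_le, Cmod_ge_0). nra.
Qed.

Lemma flat_Cder (f : C -> C) (z : C) : flat 2 f z -> Cder f z 0.
Proof.
  intros H0; pose proof (flat_at _ _ _ H0) as Hz; destruct H0 as [K [HK Hf]].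
  apply locally_Cmod in Hf; destruct Hf as [d [Hd Hf]].
  apply Cder_eps; intros e He.
  exists (Rmin d (e / (1 + K))); split; [apply Rmin_pos; [exact Hd | apply Rdiv_lt_0_compat; lra] |].
  intros y Hy.
  assert (H1 : (Cmod (y - z) < d)%R) by (eapply Rlt_le_trans; [exact Hy | apply Rmin_l]).
  assert (H2 : (Cmod (y - z) < e / (1 + K))%R) by (eapply Rlt_le_trans; [exact Hy | apply Rmin_r]).
  rewrite Hz; replace (f y - 0 - 0 * (y - z)) with (f y) by ring.
  eapply Rle_trans; [apply Hf, H1 |].
  apply (Rmult_lt_compat_r (1 + K)) in H2; [| lra].
  replace (e / (1 + K) * (1 + K))%R with e in H2 by (field; lra).
  pose proof (Cmod_ge_0 (y - z)).
  simpl. rewrite Rmult_1_r, <- Rmult_assoc; apply Rmult_le_compat_r; [assumption |]. nra.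
Qed.

Lemma Cder_flat (f : C -> C) (z l : C) :
  Cder f z l -> flat 1 (fun y => f y - f z) z.
Proof.
  intros H; rewrite Cder_eps in H; destruct (H 1%R Rlt_0_1) as [d [Hd H']].
  exists (1 + Cmod l)%R; split; [pose proof (Cmod_ge_0 l); lra |].
  apply locally_Cmod; exists d; split; [exact Hd | intros y Hy].
  replace (f y - f z) with ((f y - f z - l * (y - z)) + l * (y - z)) by ring.
  eapply Rle_trans; [apply Cmod_triangle |].
  rewrite Cmod_mult; specialize (H' y Hy). simpl; lra.
Qed.

(** Restriction to the real line, so that the real mean value theorem can be used along complex
    segments. *)
Lemma is_derive_Re_Cder (f : C -> C) (t : R) (l : C) :
  Cder f t l -> is_derive (fun s : R => Re (f (RtoC s))) t (Re l).
Proof.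
  intros H; apply is_derive_Reals; intros e He.
  rewrite Cder_eps in H; destruct (H (e / 2)%R) as [d [Hd Hd']]; [lra |].
  exists (mkposreal d Hd); intros h Hh Hhd; simpl in Hhd.
  specialize (Hd' (RtoC (t + h))).
  assert (E : RtoC (t + h) - RtoC t = RtoC h) by (rewrite RtoC_plus; ring).
  rewrite E, Cmod_R in Hd'; specialize (Hd' Hhd).
  assert (Hre : (Rabs (Re (f (RtoC (t + h))) - Re (f (RtoC t)) - Re l * h) <= e / 2 * Rabs h)%R).
  { eapply Rle_trans; [| exact Hd'].
    eapply Rle_trans; [| apply re_le_Cmod]. apply Req_le; f_equal.
    unfold Re, RtoC; simpl; ring. }
  replace ((Re (f (RtoC (t + h))) - Re (f (RtoC t))) / h - Re l)%R
    with ((Re (f (RtoC (t + h))) - Re (f (RtoC t)) - Re l * h) / h)%R by (field; exact Hh).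
  unfold Rdiv; rewrite Rabs_mult, Rabs_inv.
  assert (Hp : (0 < Rabs h)%R) by (apply Rabs_pos_lt, Hh).
  apply (Rmult_lt_reg_r (Rabs h)); [exact Hp |].
  rewrite Rmult_assoc, Rinv_l by lra. nra.
Qed.

(* Real mean value theorem for [t |-> Re (conj (f y) * f (z + t (y - z)))], which
   goes from [0] to [|f y|^2]. *)
Lemma flat_primitive (n : nat) (f g : C -> C) (z : C) :
  nearC z (fun y => Cder f y (g y)) -> f z = 0 -> flat n g z -> flat (S n) f z.
Proof.
  intros Hd Hz [K [HK Hg]]; exists K; split; [exact HK |].
  pose proof (filter_and _ _ Hd Hg) as H; apply locally_Cmod in H; destruct H as [d [Hd0 H]].
  apply locally_Cmod; exists d; split; [exact Hd0 | intros y Hy].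
  set (h := y - z) in *.
  set (c := Cconj (f y)).
  assert (Hin : forall t : R, (0 <= t <= 1)%R -> (Cmod ((z + t * h) - z) = t * Cmod h)%R).
  { intros t Ht; replace (z + t * h - z) with (t * h) by ring.
    rewrite Cmod_mult, Cmod_R, Rabs_pos_eq; lra. }
  pose proof (Cmod_ge_0 h) as Hh.
  assert (Hder : forall t : R, (0 <= t <= 1)%R ->
     is_derive (fun s : R => Re (c * f (z + RtoC s * h))) t (Re (c * (g (z + t * h) * h)))).
  { intros t Ht.
    apply (is_derive_Re_Cder (fun s => c * f (z + s * h))).
    apply Cder_scal.
    apply (Cder_comp f (fun s => z + s * h)).
    - apply H. rewrite Hin by exact Ht. nra.
    - eapply Cder_eq; [apply (Cder_plus _ _ _ _ _ (Cder_const z _) (Cder_mult _ _ _ _ _ (Cder_id _) (Cder_const h _))) |].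
      cbn beta; ring. }
  destruct (MVT_gen (fun s : R => Re (c * f (z + RtoC s * h))) 0 1
              (fun t => Re (c * (g (z + RtoC t * h) * h)))) as [t [Ht E]].
  - rewrite Rmin_left, Rmax_right by lra. intros x Hx; apply Hder; lra.
  - rewrite Rmin_left, Rmax_right by lra. intros x Hx.
    apply continuity_pt_filterlim, (ex_derive_continuous (K := R_AbsRing) (V := R_NormedModule)).
    eexists; apply Hder, Hx.
  - rewrite Rmin_left, Rmax_right in Ht by lra.
    replace (z + 1 * h) with y in E by (unfold h; ring).
    replace (z + 0 * h) with z in E by ring.
    rewrite Hz in E.
    assert (E1 : Re (c * f y) = (Cmod (f y) * Cmod (f y))%R).
    { unfold c. rewrite Cmult_comm, <- Cmod2_conj. unfold Re; simpl; ring. }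
    rewrite E1, Cmult_0_r in E. change (Re 0) with 0%R in E.
    assert (Hc : Cmod c = Cmod (f y)) by (unfold c; apply Cmod_conj).
    assert (Hb : (Cmod (f y) * Cmod (f y) <= Cmod (f y) * (Cmod (g (z + t * h)%C) * Cmod h))%R).
    { assert (Hre : (Re (c * (g (z + t * h) * h))%C <= Cmod (c * (g (z + t * h) * h))%C)%R)
        by (eapply Rle_trans; [apply Rle_abs | apply re_le_Cmod]).
      rewrite !Cmod_mult, Hc in Hre. lra. }
    assert (Hgb : (Cmod (g (z + t * h)%C) <= K * Cmod h ^ n)%R).
    { destruct (H (z + t * h)) as [_ Hb1]; [rewrite Hin by exact Ht; nra |].
      eapply Rle_trans; [exact Hb1 |]. apply Rmult_le_compat_l; [exact HK |].
      apply pow_incr. rewrite Hin by exact Ht. nra. }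
    pose proof (Cmod_ge_0 (f y)) as Hf0.
    destruct (Req_dec (Cmod (f y)) 0) as [E0 | E0].
    + rewrite E0. apply Rmult_le_pos; [exact HK | apply pow_le, Hh].
    + apply (Rmult_le_reg_l (Cmod (f y))); [lra |].
      eapply Rle_trans; [exact Hb |]. apply Rmult_le_compat_l; [exact Hf0 |].
      simpl. replace (K * (Cmod h * Cmod h ^ n))%R with (K * Cmod h ^ n * Cmod h)%R by ring.
      apply Rmult_le_compat_r; [exact Hh | exact Hgb].
Qed.

Fixpoint taylor (p : nat -> C) (n : nat) (h : C) : C :=
  match n with
  | O => 0
  | S k => taylor p k h + p k / INR (fact k) * h ^ k
  end.

Lemma taylor_ext (p q : nat -> C) (n : nat) (h : C) :
  (forall k, p k = q k) -> taylor p n h = taylor q n h.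
Proof. intros H; induction n as [|n IH]; simpl; [| rewrite IH, H]; reflexivity. Qed.

Lemma taylor_0 (p : nat -> C) (n : nat) : taylor p (S n) 0 = p 0%nat.
Proof.
  induction n as [|n IH].
  - simpl. field.
  - change (taylor p (S n) 0 + p (S n) / INR (fact (S n)) * 0 ^ S n = p 0%nat).
    rewrite IH, Cpow_S. ring.
Qed.

Lemma INR_C_neq_0 (n : nat) : n <> 0%nat -> RtoC (INR n) <> 0.
Proof. intros H E; apply RtoC_inj in E; revert E; apply not_0_INR, H. Qed.

Lemma Cder_taylor (p : nat -> C) (n : nat) (z y : C) :
  Cder (fun y => taylor p (S n) (y - z)) y (taylor (fun k => p (S k)) n (y - z)).
Proof.
  induction n as [|n IH].
  - apply (Cder_ext (fun _ => p 0%nat / INR 1)); [| apply Cder_const].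
    intros t; simpl; ring.
  - apply (Cder_plus _ _ _ _ _ IH).
    eapply Cder_eq.
    + apply Cder_scal.
      apply (Cder_comp (fun h => h ^ S n) (fun y => y - z)); [apply Cder_pow |].
      apply (Cder_minus _ _ _ _ _ (Cder_id _) (Cder_const _ _)).
    + rewrite fact_simpl, mult_INR, RtoC_mult.
      field; split; apply INR_C_neq_0; [apply fact_neq_0 | discriminate].
Qed.

(** The derivative of the remainder of [p k] is the remainder of [p (S k)] with one term fewer, so
    [flat_primitive] raises the order by one. The induction on [n] therefore needs all [k] at
    once. *)
Lemma taylor_flat (p : nat -> C -> C) (z : C) :
  (forall k, nearC z (fun y => Cder (p k) y (p (S k) y))) ->
  forall n k, flat (S n) (fun y => p k y - taylor (fun j => p (k + j)%nat z) (S n) (y - z)) z.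
Proof.
  intros Hp n; induction n as [|n IH]; intros k.
  - destruct (Cder_flat (p k) z (p (S k) z)) as [K [HK H]].
    { apply (locally_singleton _ _ (Hp k)). }
    exists K; split; [exact HK |]. eapply filter_imp; [| exact H]; intros y Hy.
    simpl. rewrite Nat.add_0_r.
    replace (p k y - (0 + p k z / 1 * 1)) with (p k y - p k z) by field. exact Hy.
  - apply flat_primitive with
      (fun y => p (S k) y - taylor (fun j => p (S k + j)%nat z) (S n) (y - z)).
    + eapply filter_imp; [| exact (Hp k)]; intros y Hy.
      apply Cder_minus; [exact Hy |].
      rewrite (taylor_ext _ (fun j => p (k + S j)%nat z)).
      * apply (Cder_taylor (fun j => p (k + j)%nat z)).
      * intros j; f_equal; lia.
    + replace (z - z) with (RtoC 0) by ring. rewrite taylor_0, Nat.add_0_r. ring.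
    + apply IH.
Qed.

(** Existence and values are carried together, so jets of composite expressions are computed by the
    rules below and read off by [jet2_derive]. The entry [c] is the second derivative itself, not
    half of it. *)
Definition jet2 (f : C -> C) (z a b c : C) : Prop :=
  f z = a /\ exists f' : C -> C,
    nearC z (fun y => Cder f y (f' y)) /\ f' z = b /\ Cder f' z c.

Lemma jet2_eq (f : C -> C) (z a b c a' b' c' : C) :
  jet2 f z a b c -> a = a' -> b = b' -> c = c' -> jet2 f z a' b' c'.
Proof. intros H <- <- <-; exact H. Qed.

Lemma jet2_derive (f : C -> C) (z a b c : C) :
  jet2 f z a b c -> C_derive f z = b /\ C_derive_n 2 f z = c.
Proof.
  intros [_ [f' [H1 [H2 H3]]]]; split.
  - rewrite <- H2; apply is_C_derive_unique, (locally_singleton _ _ H1).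
  - apply (is_C_derive_unique (C_derive f)).
    eapply Cder_ext_loc; [| exact H3].
    eapply filter_imp; [| exact H1]; intros y Hy; symmetry.
    apply is_C_derive_unique, Hy.
Qed.

Lemma jet2_ext (f g : C -> C) (z a b c : C) :
  nearC z (fun y => f y = g y) -> jet2 f z a b c -> jet2 g z a b c.
Proof.
  intros H [H0 [f' [H1 [H2 H3]]]]; split.
  - rewrite <- (locally_singleton _ _ H); exact H0.
  - exists f'; split; [| auto].
    apply locally_locally in H.
    eapply filter_imp; [| exact (filter_and _ _ H H1)]; intros y [E Hy].
    eapply Cder_ext_loc; [exact E | exact Hy].
Qed.

Lemma jet2_const (k z : C) : jet2 (fun _ => k) z k 0 0.
Proof.
  split; [reflexivity |]. exists (fun _ => 0); split; [| split; [reflexivity | apply Cder_const]].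
  apply filter_forall; intros y; apply Cder_const.
Qed.

Lemma jet2_id (z : C) : jet2 (fun y => y) z z 1 0.
Proof.
  split; [reflexivity |]. exists (fun _ => 1); split; [| split; [reflexivity | apply Cder_const]].
  apply filter_forall; intros y; apply Cder_id.
Qed.

Lemma jet2_plus (f g : C -> C) (z a b c a' b' c' : C) :
  jet2 f z a b c -> jet2 g z a' b' c' ->
  jet2 (fun y => f y + g y) z (a + a') (b + b') (c + c').
Proof.
  intros [F0 [f' [F1 [F2 F3]]]] [G0 [g' [G1 [G2 G3]]]]; split; [congruence |].
  exists (fun y => f' y + g' y); split; [| split; [congruence | apply Cder_plus; assumption]].
  eapply filter_imp; [| exact (filter_and _ _ F1 G1)]; intros y [Hf Hg].
  apply Cder_plus; assumption.
Qed.

Lemma jet2_mult (f g : C -> C) (z a b c a' b' c' : C) :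
  jet2 f z a b c -> jet2 g z a' b' c' ->
  jet2 (fun y => f y * g y) z (a * a') (b * a' + a * b') (c * a' + 2 * b * b' + a * c').
Proof.
  intros [F0 [f' [F1 [F2 F3]]]] [G0 [g' [G1 [G2 G3]]]]; split; [congruence |].
  exists (fun y => f' y * g y + f y * g' y); split; [| split; [congruence |]].
  - eapply filter_imp; [| exact (filter_and _ _ F1 G1)]; intros y [Hf Hg].
    apply Cder_mult; assumption.
  - pose proof (locally_singleton _ _ F1) as Hf; pose proof (locally_singleton _ _ G1) as Hg.
    eapply Cder_eq; [exact (Cder_plus _ _ _ _ _ (Cder_mult _ _ _ _ _ F3 Hg) (Cder_mult _ _ _ _ _ Hf G3)) |].
    cbn beta; rewrite F0, G0, F2, G2; ring.
Qed.

Lemma jet2_scal (k : C) (f : C -> C) (z a b c : C) :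
  jet2 f z a b c -> jet2 (fun y => k * f y) z (k * a) (k * b) (k * c).
Proof.
  intros H; eapply jet2_eq; [apply (jet2_mult _ _ _ _ _ _ _ _ _ (jet2_const k z) H) | ring..].
Qed.

Lemma jet2_minus (f g : C -> C) (z a b c a' b' c' : C) :
  jet2 f z a b c -> jet2 g z a' b' c' ->
  jet2 (fun y => f y - g y) z (a - a') (b - b') (c - c').
Proof.
  intros Hf Hg; apply (jet2_ext (fun y => f y + (- (1)) * g y)).
  - apply filter_forall; intros y; ring.
  - eapply jet2_eq; [apply (jet2_plus _ _ _ _ _ _ _ _ _ Hf (jet2_scal (- (1)) _ _ _ _ _ Hg)) | ring..].
Qed.

Lemma Cder_near_neq_0 (f : C -> C) (z l : C) :
  Cder f z l -> f z <> 0 -> nearC z (fun y => f y <> 0).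
Proof.
  intros H H0; apply Cmod_gt_0 in H0.
  destruct (Cder_continuous _ _ _ H _ H0) as [d [Hd H']].
  apply locally_Cmod; exists d; split; [exact Hd | intros y Hy E].
  specialize (H' y Hy); rewrite E in H'.
  replace (0 - f z) with (- f z) in H' by ring. rewrite Cmod_opp in H'; lra.
Qed.

Lemma jet2_inv (f : C -> C) (z a b c : C) :
  a <> 0 -> jet2 f z a b c ->
  jet2 (fun y => / f y) z (/ a) (- b / a ^ 2) (2 * b ^ 2 / a ^ 3 - c / a ^ 2).
Proof.
  intros Ha [F0 [f' [F1 [F2 F3]]]]; split; [congruence |].
  pose proof (locally_singleton _ _ F1) as Hf.
  assert (Hz : f z <> 0) by congruence.
  exists (fun y => - f' y * / (f y * f y)); split; [| split].
  - eapply filter_imp; [| exact (filter_and _ _ F1 (Cder_near_neq_0 _ _ _ Hf Hz))].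
    intros y [H1 H2]; apply (Cder_inv_fct _ _ _ H2 H1).
  - rewrite F0, F2; field; exact Ha.
  - eapply Cder_eq.
    + apply Cder_mult; [apply Cder_opp, F3 |].
      apply Cder_inv_fct; [apply Cmult_neq_0; exact Hz | apply Cder_mult; exact Hf].
    + cbn beta; rewrite F0, F2; field; exact Ha.
Qed.

Lemma jet2_div (f g : C -> C) (z a b c a' b' c' : C) :
  a' <> 0 -> jet2 f z a b c -> jet2 g z a' b' c' ->
  jet2 (fun y => f y / g y) z (a / a') (b / a' - a * b' / a' ^ 2)
    (c / a' - 2 * b * b' / a' ^ 2 + a * (2 * b' ^ 2 / a' ^ 3 - c' / a' ^ 2)).
Proof.
  intros Ha Hf Hg.
  eapply jet2_eq; [apply (jet2_mult _ _ _ _ _ _ _ _ _ Hf (jet2_inv _ _ _ _ _ Ha Hg)) | field; exact Ha..].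
Qed.

(** * Jets of the divided Taylor remainders *)

Definition divided_remainder (p : nat -> C -> C) (z : C) (m : nat) (y : C) : C :=
  if Ceq_dec y z then p m z / INR (fact m)
  else (p 0%nat y - taylor (fun j => p j z) m (y - z)) / (y - z) ^ m.

(** Writing [h = y - z], three more Taylor terms split [R_m] into [am + bm h + cm h^2] plus
    [f / h^m], where [f = O(h^(m+3))]. The last quotient is of order 3 and its derivative of order
    2, so neither contributes to the jet. *)
Lemma jet2_divided_remainder (p : nat -> C -> C) (z : C) (m : nat) :
  (forall k, nearC z (fun y => Cder (p k) y (p (S k) y))) ->
  jet2 (divided_remainder p z m) z
    (p m z / INR (fact m)) (p (S m) z / INR (fact (S m)))
    (2 * (p (S (S m)) z / INR (fact (S (S m))))).
Proof.
  intros Hp.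
  set (am := p m z / INR (fact m)).
  set (bm := p (S m) z / INR (fact (S m))).
  set (cm := p (S (S m)) z / INR (fact (S (S m)))).
  set (q := fun j => p j z).
  set (f := fun y => p 0%nat y - taylor q (S (S (S m))) (y - z)).
  set (f' := fun y => p 1%nat y - taylor (fun j => q (S j)) (S (S m)) (y - z)).
  assert (Ff : flat (3 + m) f z) by apply (taylor_flat p z Hp (S (S m)) 0).
  assert (Ff' : flat (2 + m) f' z) by apply (taylor_flat p z Hp (S m) 1).
  assert (Hff : nearC z (fun y => Cder f y (f' y))).
  { eapply filter_imp; [| exact (Hp 0%nat)]; intros y Hy.
    apply Cder_minus; [exact Hy | apply Cder_taylor]. }
  assert (Hneq : forall y, y <> z -> y - z <> 0).
  { intros y Hy E; apply Hy. replace y with ((y - z) + z) by ring. rewrite E; ring. }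
  assert (Hl : forall y, Cder (fun y => y - z) y 1).
  { intros y; eapply Cder_eq; [apply (Cder_minus _ _ _ _ _ (Cder_id _) (Cder_const _ _)) | ring]. }
  assert (Hpoly : forall y, Cder (fun y => am + bm * (y - z) + cm * ((y - z) * (y - z))) y
                    (bm + 2 * cm * (y - z))).
  { intros y.
    specialize (Hl y).
    eapply Cder_eq.
    - apply (Cder_plus _ _ _ _ _ (Cder_plus _ _ _ _ _ (Cder_const am y) (Cder_scal bm _ _ _ Hl))
               (Cder_scal cm _ _ _ (Cder_mult _ _ _ _ _ Hl Hl))).
    - cbn beta; ring. }
  (* The decomposition also holds at [y = z], where [f z = 0] makes the quotient 0. *)
  apply (jet2_ext (fun y => (am + bm * (y - z) + cm * ((y - z) * (y - z))) + f y / (y - z) ^ m)).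
  { apply filter_forall; intros y; unfold divided_remainder.
    destruct (Ceq_dec y z) as [-> | Hy].
    - rewrite (flat_at _ _ _ Ff). fold am. unfold Cdiv. ring.
    - unfold f. cbn [taylor]. fold q. unfold am, bm, cm, q. cbn [Cpow].
      assert (forall k, RtoC (INR (fact k)) <> 0) by (intros k; apply INR_C_neq_0, fact_neq_0).
      field. repeat split; auto. apply Cpow_nz; auto. }
  assert (Fg : flat 3 (fun y => f y / (y - z) ^ m) z) by apply flat_div, Ff.
  (* This is the quotient rule derivative of [f / h^m]. Each summand has order 2, by the orders of
     [f'] and [f]. *)
  assert (Fg' : flat 2 (fun y => f' y / (y - z) ^ m - INR m * (f y / (y - z) ^ S m)) z).
  { apply flat_minus; [apply flat_div, Ff' |].
    apply flat_scal, flat_div. replace (2 + S m)%nat with (3 + m)%nat by lia. exact Ff. }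
  assert (E0 : z - z = 0) by ring.
  split.
  { rewrite (flat_at _ _ _ Fg), E0. ring. }
  exists (fun y => (bm + 2 * cm * (y - z)) + (f' y / (y - z) ^ m - INR m * (f y / (y - z) ^ S m))).
  split; [| split].
  - eapply filter_imp; [| exact Hff]; intros y Hy.
    apply Cder_plus; [apply Hpoly |].
    (* At the centre the quotient rule does not apply; there the quotient is flat, so its derivative
       is 0, which is also the value of the formula. *)
    destruct (Ceq_dec y z) as [-> | Hyz].
    + rewrite (flat_at _ _ _ Fg'). apply flat_Cder, flat_pred, Fg.
    + apply Hneq in Hyz.
      assert (Hpw : forall k, (y - z) ^ k <> 0) by (intros k; apply Cpow_nz, Hyz).
      specialize (Hl y).
      assert (Hpow : Cder (fun y => (y - z) ^ m) y (INR m * (y - z) ^ pred m)).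
      { destruct m as [|k].
        - eapply Cder_eq; [apply (Cder_const 1) | simpl; ring].
        - eapply Cder_eq; [apply (Cder_comp (fun h => h ^ S k) _ _ _ _ (Cder_pow k _) Hl) |].
          cbn [pred]; ring. }
      eapply Cder_eq.
      * apply Cder_mult; [exact Hy |]. apply Cder_inv_fct; [apply Hpw | exact Hpow].
      * cbn beta. destruct m as [|k].
        -- simpl. field; auto.
        -- cbn [pred]. rewrite !Cpow_S. field. split; auto.
  - rewrite (flat_at _ _ _ Fg'), E0. ring.
  - eapply Cder_eq.
    + apply Cder_plus; [| apply flat_Cder, Fg'].
      apply Cder_plus; [apply Cder_const |].
      apply Cder_scal, Hl.
    + ring.
Qed.

(** * The logarithm of the difference quotient *)

Lemma Cexp_plus (a b : C) : Cexp (a + b) = Cexp a * Cexp b.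
Proof.
  unfold Cexp, Cmult, Cplus, Re, Im; simpl.
  rewrite exp_plus, cos_plus, sin_plus; f_equal; ring.
Qed.

Lemma Cexp_0 : Cexp 0 = 1.
Proof. unfold Cexp, Re, Im; simpl; rewrite exp_0, cos_0, sin_0; unfold RtoC; f_equal; ring. Qed.

Lemma Cexp_neq_0 (a : C) : Cexp a <> 0.
Proof.
  intros E; apply C1_nz. rewrite <- Cexp_0.
  replace (RtoC 0) with (a + - a) by ring. rewrite Cexp_plus, E; ring.
Qed.

Lemma Cmod_le_Re_Im (x : C) : (Cmod x <= Rabs (Re x) + Rabs (Im x))%R.
Proof.
  replace x with (RtoC (Re x) + Ci * RtoC (Im x)) at 1.
  - eapply Rle_trans; [apply Cmod_triangle |].
    rewrite Cmod_mult, !Cmod_R, Cmod_Ci. lra.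
  - destruct x; unfold Ci, RtoC, Cmult, Cplus, Re, Im; simpl; f_equal; ring.
Qed.

Lemma derivable_pt_lim_le (f : R -> R) (x l : R) :
  derivable_pt_lim f x l -> forall e : R, (0 < e)%R -> exists d : R, (0 < d)%R /\
    forall h : R, (Rabs h < d)%R -> (Rabs (f (x + h) - f x - l * h) <= e * Rabs h)%R.
Proof.
  intros H e He; destruct (H e He) as [d Hd]; exists d; split; [apply cond_pos | intros h Hh].
  destruct (Req_dec h 0) as [-> | H0].
  - rewrite Rplus_0_r, Rmult_0_r, Rminus_diag, Rminus_diag, Rabs_R0; lra.
  - replace (f (x + h) - f x - l * h)%R with (((f (x + h) - f x) / h - l) * h)%R by (field; exact H0).
    rewrite Rabs_mult; apply Rmult_le_compat_r; [apply Rabs_pos |].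
    left; apply Hd; assumption.
Qed.

Lemma Cder_Cexp_0 : Cder Cexp 0 1.
Proof.
  apply Cder_eps; intros e0 He0.
  (* 7 = 3 + 4: the error is at most [3 e m] in the real part and [4 e m] in the imaginary part. *)
  set (e := (e0 / 7)%R). assert (He : (0 < e)%R) by (unfold e; lra).
  destruct (derivable_pt_lim_le _ _ _ (derivable_pt_lim_exp 0) e He) as [d1 [Hd1 H1]].
  destruct (derivable_pt_lim_le _ _ _ (derivable_pt_lim_cos 0) e He) as [d2 [Hd2 H2]].
  destruct (derivable_pt_lim_le _ _ _ (derivable_pt_lim_sin 0) e He) as [d3 [Hd3 H3]].
  (* The bound [e] controls the cross term [a * b] of the imaginary part, and the bound 1 gives
     [|1 + a| <= 2]. *)
  exists (Rmin (Rmin d1 d2) (Rmin d3 (Rmin e 1))); split; [repeat apply Rmin_pos; lra |].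
  intros y; rewrite Cexp_0; replace (y - 0) with y by ring; rewrite Cmult_1_l; intros Hy.
  repeat apply Rmin_Rgt_l in Hy; destruct Hy as [Hy1 Hy2].
  apply Rmin_Rgt_l in Hy1; apply Rmin_Rgt_l in Hy2.
  destruct Hy1 as [Hy1 Hy3]; destruct Hy2 as [Hy4 Hy2]; apply Rmin_Rgt_l in Hy2; destruct Hy2 as [Hy5 Hy6].
  set (m := Cmod y) in *.
  pose proof (Rmax_Cmod y) as HM.
  destruct y as [a b]; simpl in HM; fold m in HM.
  assert (Ha : (Rabs a <= m)%R) by (eapply Rle_trans; [apply Rmax_l | exact HM]).
  assert (Hb : (Rabs b <= m)%R) by (eapply Rle_trans; [apply Rmax_r | exact HM]).
  specialize (H1 a ltac:(lra)); specialize (H2 b ltac:(lra)); specialize (H3 b ltac:(lra)).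
  rewrite Rplus_0_l in H1, H2, H3; rewrite exp_0 in H1; rewrite sin_0, cos_0 in H2; rewrite sin_0, cos_0 in H3.
  eapply Rle_trans; [apply Cmod_le_Re_Im |].
  assert (Hcos : (Rabs (cos b) <= 1)%R) by (apply Rabs_le, COS_bound).
  assert (Hsin : (Rabs (sin b) <= 1)%R) by (apply Rabs_le, SIN_bound).
  pose proof (Rabs_pos a); pose proof (Rabs_pos b).
  assert (H1a : (Rabs (1 + a) <= 2)%R).
  { eapply Rle_trans; [apply Rabs_triang |]. rewrite Rabs_R1; lra. }
  assert (B1 : (Rabs (exp a - 1 - 1 * a) <= e * m)%R)
    by (eapply Rle_trans; [exact H1 |]; apply Rmult_le_compat_l; lra).
  assert (B2 : (Rabs (cos b - 1 - - 0 * b) <= e * m)%R)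
    by (eapply Rle_trans; [exact H2 |]; apply Rmult_le_compat_l; lra).
  assert (B3 : (Rabs (sin b - 0 - 1 * b) <= e * m)%R)
    by (eapply Rle_trans; [exact H3 |]; apply Rmult_le_compat_l; lra).
  assert (Hre : (Rabs (Re (Cexp (a, b) - 1 - (a, b))) <= 3 * (e * m))%R).
  { replace (Re (Cexp (a, b) - 1 - (a, b)))
      with ((exp a - 1 - 1 * a) * cos b + (1 + a) * (cos b - 1 - - 0 * b))%R
      by (unfold Cexp, Re, Im, Cminus, Cplus, Copp, RtoC; simpl; ring).
    eapply Rle_trans; [apply Rabs_triang |]. rewrite !Rabs_mult.
    assert (Rabs (exp a - 1 - 1 * a) * Rabs (cos b) <= (e * m) * 1)%R
      by (apply Rmult_le_compat; auto using Rabs_pos).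
    assert (Rabs (1 + a) * Rabs (cos b - 1 - - 0 * b) <= 2 * (e * m))%R
      by (apply Rmult_le_compat; auto using Rabs_pos).
    lra. }
  assert (Him : (Rabs (Im (Cexp (a, b) - 1 - (a, b))) <= 4 * (e * m))%R).
  { replace (Im (Cexp (a, b) - 1 - (a, b)))
      with ((exp a - 1 - 1 * a) * sin b + (1 + a) * (sin b - 0 - 1 * b) + a * b)%R
      by (unfold Cexp, Re, Im, Cminus, Cplus, Copp, RtoC; simpl; ring).
    eapply Rle_trans; [apply Rabs_triang |].
    eapply Rle_trans; [apply Rplus_le_compat_r, Rabs_triang |]. rewrite !Rabs_mult.
    assert (Rabs (exp a - 1 - 1 * a) * Rabs (sin b) <= (e * m) * 1)%R
      by (apply Rmult_le_compat; auto using Rabs_pos).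
    assert (Rabs (1 + a) * Rabs (sin b - 0 - 1 * b) <= 2 * (e * m))%R
      by (apply Rmult_le_compat; auto using Rabs_pos).
    assert (Rabs a * Rabs b <= e * m)%R by (apply Rmult_le_compat; lra).
    lra. }
  replace (e0 * m)%R with (3 * (e * m) + 4 * (e * m))%R by (unfold e; field).
  lra.
Qed.

Lemma Cder_Cexp (z : C) : Cder Cexp z (Cexp z).
Proof.
  apply (Cder_ext (fun y => Cexp z * Cexp (y - z))).
  - intros t; rewrite <- Cexp_plus; f_equal; ring.
  - eapply Cder_eq.
    + apply Cder_scal, (Cder_comp Cexp (fun y => y - z)).
      * replace (z - z) with (RtoC 0) by ring; apply Cder_Cexp_0.
      * apply (Cder_minus _ _ _ _ _ (Cder_id _) (Cder_const _ _)).
    + ring.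
Qed.

(** Differentiating [Cexp (q y) = D y] gives [q' = D' / D] on a neighbourhood, and the right side
    can be differentiated once more. That [d0] is nonzero, being a value of [Cexp], is recorded for
    the later divisions. *)
Lemma log_derive2 (q D : C -> C) (z d0 d1 d2 : C) :
  nearC z (fun y => ex_derive (K := C_AbsRing) (V := C_NormedModule) q y /\ Cexp (q y) = D y) ->
  jet2 D z d0 d1 d2 ->
  d0 <> 0 /\ C_derive q z = d1 / d0 /\ C_derive_n 2 q z = d2 / d0 - (d1 / d0) ^ 2.
Proof.
  intros Hq [D0 [D' [D1 [D2 D3]]]].
  assert (Hz0 : d0 <> 0).
  { rewrite <- D0, <- (proj2 (locally_singleton _ _ Hq)); apply Cexp_neq_0. }
  assert (Hd : nearC z (fun y => D' y / D y = C_derive q y)).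
  { apply locally_locally in Hq.
    eapply filter_imp; [| exact (filter_and _ _ Hq D1)]; intros y [Hy HD].
    destruct (locally_singleton _ _ Hy) as [Hex E].
    pose proof (C_derive_correct _ _ y Hex) as Hc.
    assert (H1 : Cder D y (Cexp (q y) * C_derive q y)).
    { apply (Cder_ext_loc (fun t => Cexp (q t))).
      - eapply filter_imp; [| exact Hy]; intros t [_ Ht]; exact Ht.
      - apply Cder_comp; [apply Cder_Cexp | exact Hc]. }
    assert (H2 : D' y = Cexp (q y) * C_derive q y).
    { rewrite <- (is_C_derive_unique _ _ _ HD); apply is_C_derive_unique, H1. }
    rewrite H2, <- E; field; apply Cexp_neq_0. }
  split; [exact Hz0 |]; split.
  - rewrite <- (locally_singleton _ _ Hd), D0, D2; reflexivity.
  - apply (is_C_derive_unique (C_derive q)).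
    apply (Cder_ext_loc _ _ _ _ Hd).
    eapply Cder_eq.
    + apply Cder_mult; [exact D3 |].
      apply Cder_inv_fct; [congruence | apply (locally_singleton _ _ D1)].
    + cbn beta; rewrite D0, D2; field; exact Hz0.
Qed.

(** The joint differential [l] is composed with the affine map sending [y] to [(z, y)]; linearity of
    [l] makes [l (0, 1)] the derivative. *)
Lemma is_Qe_ex_derive (psi : C -> C) (Q : C -> C -> C) (z w : C) :
  is_Qe psi Q -> De z -> De w ->
  ex_derive (K := C_AbsRing) (V := C_NormedModule) (Q z) w.
Proof.
  intros [H _] Hz Hw; destruct (H z w Hz Hw) as [l Hl].
  exists (l (RtoC 0, RtoC 1)).
  pose proof (Cder_id w) as Hid.
  apply (filterdiff_ext_lin (K := C_AbsRing) (U := AbsRing_NormedModule C_AbsRing)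
           (V := C_NormedModule) (Q z) (fun y : C => l (RtoC 0, y * 1))).
  - apply (filterdiff_comp'_2 (K := C_AbsRing) (T := AbsRing_NormedModule C_AbsRing)
             (U := C_NormedModule) (V := C_NormedModule) (W := C_NormedModule)
             (fun _ => z) (fun y => y) Q w (fun _ => RtoC 0) (fun y : C => y * 1) (fun a b => l (a, b))).
    + apply (filterdiff_const (K := C_AbsRing) (V := C_NormedModule)).
    + exact Hid.
    + apply (filterdiff_ext_lin (K := C_AbsRing) _ _ _ Hl).
      intros [a b]; reflexivity.
  - intros y.
    rewrite <- (linear_scal _ (proj1 Hl)).
    apply (f_equal l).
    change ((RtoC 0, Cmult y 1) = (Cmult y 0, Cmult y 1)); f_equal; ring.
Qed.

Lemma jet2_holomorphic (p : nat -> C -> C) (z : C) (k : nat) :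
  (forall k, nearC z (fun y => Cder (p k) y (p (S k) y))) ->
  jet2 (p k) z (p k z) (p (S k) z) (p (S (S k)) z).
Proof.
  intros H; split; [reflexivity |].
  exists (p (S k)); split; [apply H |]; split; [reflexivity |].
  apply (locally_singleton _ _ (H (S k))).
Qed.

Lemma Qe_derive2 (psi : C -> C) (Q : C -> C -> C) (z y : C) :
  Sigma psi -> is_Qe psi Q -> De z -> De y ->
  let R := divided_remainder (fun k => C_derive_n k psi) z in
  R 1%nat y <> 0 /\
  C_derive_n 1 (Q y) z = R 2%nat y / R 1%nat y /\
  C_derive_n 2 (Q y) z = 2 * R 3%nat y / R 1%nat y - (R 2%nat y / R 1%nat y) ^ 2.
Proof.
  intros HS HQ Hz Hy.
  set (p := fun k => C_derive_n k psi).
  assert (Hp : forall k, nearC z (fun y => Cder (p k) y (p (S k) y))).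
  { intros k; eapply filter_imp; [| apply De_locally, Hz].
    intros x Hx; apply (Sigma_derive_n psi HS), Hx. }
  assert (Hlog : forall x, De x ->
            ex_derive (K := C_AbsRing) (V := C_NormedModule) (Q y) x /\
            Cexp (Q y x) = diff_quot psi y x).
  { intros x Hx; split; [apply (is_Qe_ex_derive psi Q y x HQ Hy Hx) | apply HQ; assumption]. }
  destruct (Ceq_dec y z) as [-> | Hyz].
  (* For [y = z] the difference quotient is, by symmetry, [R_1] as a function of its second
     variable. Its jet at [z] consists of [R_1(z)], [R_2(z)] and [2 R_3(z)], so the formulas agree
     with those off the diagonal. *)
  - assert (Hnear : nearC z (fun x =>
              ex_derive (K := C_AbsRing) (V := C_NormedModule) (Q z) x /\
              Cexp (Q z x) = divided_remainder p z 1 x)).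
    { eapply filter_imp; [| apply De_locally, Hz]; intros x Hx.
      destruct (Hlog x Hx) as [E1 E2]; split; [exact E1 |].
      rewrite E2; unfold diff_quot, divided_remainder, p; simpl.
      destruct (Ceq_dec x z) as [-> | Hx0]; destruct (Ceq_dec z _) as [E | E]; try congruence.
      - field.
      - field; split; intros E'; [apply Hx0 | apply E].
        + replace x with ((x - z) + z) by ring; rewrite E'; ring.
        + replace z with ((z - x) + x) by ring; rewrite E'; ring. }
    destruct (log_derive2 _ _ _ _ _ _ Hnear (jet2_divided_remainder p z 1 Hp)) as [H0 [H1 H2]].
    cbn zeta. fold p. unfold divided_remainder.
    destruct (Ceq_dec z z) as [_ | E]; [| congruence].
    split; [exact H0 |]. split; [exact H1 |].
    rewrite H2. unfold Cdiv; ring.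
  - assert (Hyz' : y - z <> 0).
    { intros E; apply Hyz; replace y with ((y - z) + z) by ring; rewrite E; ring. }
    (* Off the diagonal the quotient rule applies directly: the three entries are the value and the
       first two [x]-derivatives at [z], equal to [R_1(y)], [R_2(y)] and [2 R_3(y)]. *)
    destruct (log_derive2 (Q y) (fun x => (psi y - psi x) / (y - x)) z
       ((psi y - psi z) / (y - z))
       (- p 1%nat z / (y - z) + (psi y - psi z) / (y - z) ^ 2)
       (- p 2%nat z / (y - z) - 2 * p 1%nat z / (y - z) ^ 2 + 2 * (psi y - psi z) / (y - z) ^ 3)) as [H0 [H1 H2]].
    + assert (Hne : nearC z (fun x => y - x <> 0)).
      { apply (Cder_near_neq_0 _ _ _ (Cder_minus _ _ _ _ _ (Cder_const y z) (Cder_id z)) Hyz'). }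
      eapply filter_imp; [| exact (filter_and _ _ Hne (De_locally z Hz))]; intros x [Hx0 Hx].
      destruct (Hlog x Hx) as [E1 E2]; split; [exact E1 |].
      rewrite E2; unfold diff_quot; destruct (Ceq_dec y x) as [-> | _]; [| reflexivity].
      exfalso; apply Hx0; ring.
    + eapply jet2_eq.
      * apply (jet2_div _ _ _ _ _ _ _ _ _ Hyz'
          (jet2_minus _ _ _ _ _ _ _ _ _ (jet2_const (psi y) z) (jet2_holomorphic p z 0 Hp))
          (jet2_minus _ _ _ _ _ _ _ _ _ (jet2_const y z) (jet2_id z))).
      * reflexivity.
      * change (p 0%nat z) with (psi z). field; exact Hyz'.
      * change (p 0%nat z) with (psi z). field; exact Hyz'.
    + assert (Hpsi : psi y - psi z <> 0).
      { intros E; apply H0; rewrite E; field; exact Hyz'. }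
      cbn zeta. unfold divided_remainder. fold p.
      destruct (Ceq_dec y z) as [E | _]; [congruence |].
      cbn [taylor]. change (p 0%nat y) with (psi y); change (p 0%nat z) with (psi z).
      assert (F0 : RtoC (INR (fact 0)) = 1) by reflexivity.
      assert (F1 : RtoC (INR (fact 1)) = 1) by reflexivity.
      assert (F2 : RtoC (INR (fact 2)) = 2) by reflexivity.
      rewrite F0, F1, F2.
      assert (E1 : (psi y - (0 + psi z / 1 * (y - z) ^ 0)) / (y - z) ^ 1 = (psi y - psi z) / (y - z))
        by (field; exact Hyz').
      rewrite E1. split; [exact H0 |]. split.
      * change (C_derive_n 1 (Q y) z) with (C_derive (Q y) z).
        rewrite H1. field; auto.
      * rewrite H2. field; auto.
Qed.

(** * Comparison of the two diagonal Schwarzians *)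

Theorem theorem4p8 :
  forall (psi : C -> C) (Q : C -> C -> C),
    Sigma psi ->
    is_Qe psi Q ->
    forall z : C, De z ->
      diag_schwarzian 2 Q z =
        1 / 5 * C_derive_n 2 (diag_schwarzian 1 Q) z
        - 6 / 5 * (diag_schwarzian 1 Q z) ^ 2 /\
      1 / 5 * C_derive_n 2 (diag_schwarzian 1 Q) z
        - 6 / 5 * (diag_schwarzian 1 Q z) ^ 2 =
        1 / 30 * (C_derive_n 2 (schwarzian psi) z - (schwarzian psi z) ^ 2).
Proof.
  intros psi Q HS HQ z Hz.
  set (p := fun k => C_derive_n k psi).
  assert (Hp : forall x, De x -> forall k, nearC x (fun y => Cder (p k) y (p (S k) y))).
  { intros x Hx k; eapply filter_imp; [| apply De_locally, Hx].
    intros y Hy; apply (Sigma_derive_n psi HS), Hy. }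
  (* [psi' x] is the value of [Cexp (Q x x)], hence nonzero. *)
  assert (Hp1 : forall x, De x -> p 1%nat x <> 0).
  { intros x Hx E; destruct (Qe_derive2 psi Q x x HS HQ Hx Hx) as [H _]; apply H.
    unfold divided_remainder; destruct (Ceq_dec x x) as [_ | N]; [| congruence].
    change (C_derive_n 1 psi x) with (p 1%nat x); rewrite E; simpl; field. }
  assert (HR : forall x m, De x -> jet2 (divided_remainder p x m) x
    (p m x / INR (fact m)) (p (S m) x / INR (fact (S m)))
    (2 * (p (S (S m)) x / INR (fact (S (S m)))))).
  { intros x m Hx; apply jet2_divided_remainder, Hp, Hx. }
  assert (F1 : RtoC (INR (fact 1)) = 1) by reflexivity.
  assert (F2 : RtoC (INR (fact 2)) = 2) by reflexivity.
  assert (F3 : RtoC (INR (fact 3)) = 6) by (f_equal; simpl; ring).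
  assert (F4 : RtoC (INR (fact 4)) = 24) by (f_equal; simpl; ring).
  assert (F5 : RtoC (INR (fact 5)) = 120) by (f_equal; simpl; ring).
  assert (Hp1' : forall x, De x -> p 1%nat x / INR (fact 1) <> 0).
  { intros x Hx; rewrite F1; replace (p 1%nat x / 1) with (p 1%nat x) by field; apply Hp1, Hx. }
  (* One sixth of [psi'''/psi' - (3/2) (psi''/psi')^2], arranged so that the jet rules for products
     and quotients apply. *)
  set (S2 := fun x => p 3%nat x / p 1%nat x * / 6 - (p 2%nat x / p 1%nat x) * (p 2%nat x / p 1%nat x) * / 4).
  (* Needed at every point of [De], not only at [z], because both sides are differentiated twice
     later; the base point of the remainders moves with [x]. *)
  assert (HS2 : forall x, De x -> diag_schwarzian 1 Q x = S2 x).
  { intros x Hx; unfold diag_schwarzian.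
    match goal with |- C_derive_n 1 ?f x = _ => change (C_derive_n 1 f x) with (C_derive f x) end.
    assert (J := jet2_div _ _ _ _ _ _ _ _ _ (Hp1' x Hx) (HR x 2%nat Hx) (HR x 1%nat Hx)).
    eapply jet2_ext in J.
    - rewrite (proj1 (jet2_derive _ _ _ _ _ J)), F1, F2, F3. unfold S2.
      field; apply Hp1, Hx.
    - eapply filter_imp; [| apply De_locally, Hx]; intros y Hy; symmetry.
      apply (Qe_derive2 psi Q x y HS HQ Hx Hy). }
  assert (HSch : forall x, De x -> schwarzian psi x = 6 * S2 x).
  { intros x Hx; unfold schwarzian.
    assert (J := jet2_div _ _ _ _ _ _ _ _ _ (Hp1 x Hx)
      (jet2_holomorphic p x 2 (Hp x Hx)) (jet2_holomorphic p x 1 (Hp x Hx))).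
    change (C_derive (pre_schwarzian psi) x) with (C_derive (fun y => p 2%nat y / p 1%nat y) x).
    change (pre_schwarzian psi x) with (p 2%nat x / p 1%nat x).
    rewrite (proj1 (jet2_derive _ _ _ _ _ J)). unfold S2. field; apply Hp1, Hx. }
  (* The existential hides the long expression for [c = S2''(z)] once the identity in
     [psi', ..., psi^(5)] has been checked by [field]; what remains only concerns [c] and [S2 z]. *)
  assert (JS2 : exists a b c, jet2 S2 z a b c /\ c = C_derive_n 2 S2 z /\
     diag_schwarzian 2 Q z = 1 / 5 * c - 6 / 5 * (S2 z) ^ 2).
  { pose proof (jet2_holomorphic p z 1 (Hp z Hz)) as J1.
    pose proof (jet2_div _ _ _ _ _ _ _ _ _ (Hp1 z Hz) (jet2_holomorphic p z 2 (Hp z Hz)) J1) as J2.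
    pose proof (jet2_div _ _ _ _ _ _ _ _ _ (Hp1 z Hz) (jet2_holomorphic p z 3 (Hp z Hz)) J1) as J3.
    assert (J := jet2_minus _ _ _ _ _ _ _ _ _
      (jet2_mult _ _ _ _ _ _ _ _ _ J3 (jet2_const (/ 6) z))
      (jet2_mult _ _ _ _ _ _ _ _ _ (jet2_mult _ _ _ _ _ _ _ _ _ J2 J2) (jet2_const (/ 4) z))).
    eexists _, _, _; split; [exact J |]; split.
    - symmetry; apply (jet2_derive _ _ _ _ _ J).
    - unfold diag_schwarzian.
      assert (K2 := jet2_div _ _ _ _ _ _ _ _ _ (Hp1' z Hz) (HR z 2%nat Hz) (HR z 1%nat Hz)).
      assert (K3 := jet2_div _ _ _ _ _ _ _ _ _ (Hp1' z Hz) (jet2_scal 2 _ _ _ _ _ (HR z 3%nat Hz)) (HR z 1%nat Hz)).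
      assert (K := jet2_minus _ _ _ _ _ _ _ _ _ K3 (jet2_mult _ _ _ _ _ _ _ _ _ K2 K2)).
      eapply jet2_ext in K.
      + rewrite (proj2 (jet2_derive _ _ _ _ _ K)), F1, F2, F3, F4, F5. unfold S2.
        field; apply Hp1, Hz.
      + eapply filter_imp; [| apply De_locally, Hz]; intros y Hy; symmetry.
        etransitivity; [apply (Qe_derive2 psi Q z y HS HQ Hz Hy) |].
        fold p. simpl; ring. }
  destruct JS2 as [a [b [c [J [Ec E]]]]].
  assert (D1 : C_derive_n 2 (diag_schwarzian 1 Q) z = c).
  { eapply jet2_derive, jet2_ext; [| exact J].
    eapply filter_imp; [| apply De_locally, Hz]; intros y Hy; symmetry; apply HS2, Hy. }
  assert (D2 : C_derive_n 2 (schwarzian psi) z = 6 * c).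
  { eapply jet2_derive, jet2_ext; [| exact (jet2_scal 6 _ _ _ _ _ J)].
    eapply filter_imp; [| apply De_locally, Hz]; intros y Hy; symmetry; apply HSch, Hy. }
  rewrite E, D1, D2, (HS2 z Hz), (HSch z Hz).
  (* The second equality is [(6 c - 36 S2^2) / 30 = c / 5 - (6/5) S2^2], from the relation that the
     Schwarzian is [6 S2]. *)
  split; [reflexivity | field].
Qed.
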